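(* Let $(G,m,w,B)$ be a connected weighted finite graph with boundary, with vertex set $V$ and interior $\Omega=V\setminus B$. Let $\mu_1\le\cdots\le\mu_{|V|}$ be its Laplacian eigenvalues and $\sigma_1\le\cdots\le\sigma_{|B|}$ its Steklov eigenvalues. Then $$\sigma_i\ge\mu_i\qquad\text{for } i=1,2,\dots,|B|.$$ If $\sigma_i=\mu_i$ for some $i\in\{2,3,\dots,|B|\}$, then there is an eigenfunction $v_i$ of $-\Delta$ with eigenvalue $\mu_i$ such that $v_i|_\Omega=0$ and $(\Delta v_i)|_\Omega=0$. Moreover, if $|B|\ge 2$, then $\sigma_i=\mu_i$ holds for all $i=1,2,\dots,|B|$ if and only if the following two statements are true: (1) There is a nonnegative function $\rho\in\mathbb{R}^\Omega$ such that $w_{xy}=\rho_y m_x m_y$ for each $x\in B$ and $y\in\Omega$. (In particular, each interior vertex is either adjacent to all boundary vertices or adjacent to no boundary vertices.) (2) For this $\rho$ and for any $u\in\mathbb{R}^\Omega$ with $\langle u,1\rangle_\Omega=0$, $$\langle du,du\rangle_\Omega-\mathrm{Deg}\,\langle u,u\rangle_\Omega+V_B\langle\rho u,u\rangle_\Omega-\frac{V_G}{\mathrm{Deg}}\langle\rho,u\rangle_\Omega^2\ge 0,$$ where $\mathrm{Deg}:=\langle\rho,1\rangle_\Omega$ (which equals the weighted degree $\mathrm{Deg}(x)$ of every $x\in B$), $V_B=\sum_{x\in B}m_x$, $V_\Omega=\sum_{y\in\Omega}m_y$ and $V_G=V_B+V_\Omega$.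
   Context: A weighted graph $(G,m,w)$ consists of a finite, simple, connected graph $G$ with vertex set $V$ and edge set $E$, a positive function $m$ on $V$ (vertex measure, written $m_x$), and a positive function $w$ on $E$ (edge weight), regarded as a symmetric function $w_{xy}$ on $V\times V$ by setting $w_{xy}=0$ when $\{x,y\}\notin E$. The weighted degree of $x\in V$ is $\mathrm{Deg}(x)=\frac1{m_x}\sum_{y\in V}w_{xy}$. Graph with boundary: $(G,m,w,B)$ is a weighted graph together with a nonempty set $B\subset V$ (the boundary) such that no two vertices of $B$ are adjacent and every vertex of $B$ is adjacent to some vertex of $\Omega:=V\setminus B$ (the interior). Laplacian: for $u\in\mathbb{R}^V$, $\Delta u(x)=\frac1{m_x}\sum_{y\in V}(u(y)-u(x))w_{xy}$. The operator $-\Delta$ is nonnegative and self-adjoint for $\langle u,v\rangle=\sum_{x\in V}u(x)v(x)m_x$; its eigenvalues, counted with multiplicity, are $0=\mu_1<\mu_2\le\cdots\le\mu_{|V|}$. Steklov eigenvalues: for $f\in\mathbb{R}^B$ let $u_f\in\mathbb{R}^V$ be the unique function with $u_f=f$ on $B$ and $\Delta u_f=0$ on $\Omega$. The Dirichlet-to-Neumann map $\Lambda:\mathbb{R}^B\to\mathbb{R}^B$ is $\Lambda f(x)=\frac{\partial u_f}{\partial n}(x)$, where $\frac{\partial u}{\partial n}(x)=\frac1{m_x}\sum_{y\in V}(u(x)-u(y))w_{xy}$ for $x\in B$. It is nonnegative and self-adjoint for $\langle f,g\rangle_B=\sum_{x\in B}f(x)g(x)m_x$; its eigenvalues, counted with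 multiplicity, are $0=\sigma_1<\sigma_2\le\cdots\le\sigma_{|B|}$. Notation: $\langle u,v\rangle_\Omega=\sum_{x\in\Omega}u(x)v(x)m_x$, and $\langle du,du\rangle_\Omega=\sum_{\{x,y\}\in E,\ x,y\in\Omega}(u(x)-u(y))^2w_{xy}$ (sum over unordered edges with both endpoints in $\Omega$). *)

(* Defs.v *)
From mathcomp Require Import all_boot all_order all_algebra.
From mathcomp Require Import polyrcf.
From mathcomp Require Import boolp classical_sets reals.

Set Implicit Arguments.
Unset Strict Implicit.
Unset Printing Implicit Defensive.

Import Order.TTheory GRing.Theory Num.Theory.
Local Open Scope ring_scope.

Section Spectrum.
Variables (R : realType) (T : finType).

(* Matrix of an operator on R^T in the basis of indicator functions of points,
   enumerated by [enum T]; images of basis vectors are the columns. *)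
Definition op_mx (L : (T -> R) -> (T -> R)) : 'M[R]_#|T| :=
  \matrix_(i, j) L (fun y => (y == enum_val j)%:R) (enum_val i).

(* [rootsR p] is the increasing list of the distinct roots of [p]; each root is
   repeated according to its multiplicity. *)
Definition spectrum (L : (T -> R) -> (T -> R)) : seq R :=
  let p := char_poly (op_mx L) in
  flatten [seq nseq (mup x p) x | x <- rootsR p].

(* The index [i] is 1-based. *)
Definition eigval (L : (T -> R) -> (T -> R)) (i : nat) : R :=
  nth 0 (spectrum L) i.-1.

Definition eigenfunction (L : (T -> R) -> (T -> R)) (a : R) (v : T -> R) :=
  (exists x, v x != 0) /\ (forall x, L v x = a * v x).

End Spectrum.

Section Graph.
Variables (R : realType) (V : finType).
Implicit Types (E : rel V) (m : V -> R) (w : V -> V -> R) (B : {set V}).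

Definition weighted_graph E m w : Prop :=
  [/\ symmetric E, irreflexive E & forall x y, connect E x y] /\
  [/\ forall x, 0 < m x,
      forall x y, w x y = w y x,
      forall x y, E x y -> 0 < w x y &
      forall x y, ~~ E x y -> w x y = 0].

Definition graph_boundary E B : Prop :=
  [/\ B != finset.set0,
      forall x y, x \in B -> y \in B -> ~~ E x y &
      forall x, x \in B -> exists2 y, y \notin B & E x y].

Definition bvertex B : finType := {x : V | x \in B}.
Definition interior B : finType := {y : V | y \notin B}.

Definition wdeg m w (x : V) : R := (m x)^-1 * \sum_y w x y.

Definition laplacian m w (u : V -> R) (x : V) : R :=
  (m x)^-1 * \sum_y (u y - u x) * w x y.

Definition neg_laplacian m w (u : V -> R) (x : V) : R := - laplacian m w u x.

Definition normal_deriv m w (u : V -> R) (x : V) : R :=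
  (m x)^-1 * \sum_y (u x - u y) * w x y.

Definition is_harmonic_ext m w B (f : bvertex B -> R) (u : V -> R) : Prop :=
  (forall x : bvertex B, u (val x) = f x) /\
  (forall y : interior B, laplacian m w u (val y) = 0).

(* The unique harmonic extension of [f], by definite description. *)
Definition harmonic_ext m w B (f : bvertex B -> R) : V -> R :=
  xget (fun=> 0) (is_harmonic_ext m w f).

Definition DtN m w B (f : bvertex B -> R) (x : bvertex B) : R :=
  normal_deriv m w (harmonic_ext m w f) (val x).

Definition mu m w (i : nat) : R := eigval (neg_laplacian m w) i.

Definition sigma m w B (i : nat) : R := eigval (@DtN m w B) i.

Definition volume m (A : {set V}) : R := \sum_(x in A) m x.

Definition inner_int m B (u v : interior B -> R) : R :=
  \sum_y u y * v y * m (val y).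

(* Each unordered edge inside the interior occurs twice as an ordered pair,
   whence the factor 1/2. *)
Definition energy_int E w B (u : interior B -> R) : R :=
  2^-1 * \sum_(x : interior B) \sum_(y : interior B | E (val x) (val y))
           (u x - u y) ^+ 2 * w (val x) (val y).

Definition product_weight m w B (rho : interior B -> R) : Prop :=
  (forall y, 0 <= rho y) /\
  (forall (x : bvertex B) (y : interior B),
     w (val x) (val y) = rho y * m (val x) * m (val y)).

Definition interior_ineq E m w B (rho : interior B -> R) : Prop :=
  let Dg := inner_int m rho (fun=> 1) in
  let VB := volume m B in
  let VG := VB + volume m (~: B)%SET in
  forall u : interior B -> R, inner_int m u (fun=> 1) = 0 ->
  0 <= energy_int E w u - Dg * inner_int m u u
       + VB * inner_int m (fun y => rho y * u y) u
       - VG / Dg * inner_int m rho u ^+ 2.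

End Graph.

(* Main.v *)
Require Import Defs.
From mathcomp Require Import all_boot all_order all_algebra.
From mathcomp Require Import polyrcf complex perm ring.
From mathcomp Require spectral.
From mathcomp Require Import boolp classical_sets reals.

(* Write [q u] for the Dirichlet energy. If [f] is a combination of the first [i]
   Steklov eigenfunctions whose harmonic extension [u] is orthogonal to the first
   [i - 1] Laplacian eigenfunctions, then
     [mu_i |u|^2 <= q u = <Lambda f, f>_B <= sigma_i |f|_B^2 <= sigma_i |u|^2],
   and such an [f != 0] exists by counting dimensions. Equality (with [mu_i > 0])
   forces [u] to vanish on the interior and to be an eigenfunction of both
   operators. When all the eigenvalues agree, every [f] of zero mean has an
   extension vanishing on the interior, which makes the weights between the
   boundary and the interior a product. For product weights
   [sigma_i = Deg] for [i >= 2], so equality of the spectra is the Poincare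
   inequality [q u >= Deg |u|^2] on [u] orthogonal to constants; minimising over
   the difference of the mean values of [u] on the boundary and on the interior
   turns it into statement (2). *)

Set Implicit Arguments.
Unset Strict Implicit.
Unset Printing Implicit Defensive.

Import Order.TTheory GRing.Theory Num.Theory.
Local Open Scope ring_scope.

(** * Spectral theorem *)

(** Multiplying both sides by [\det P], which cancels in the integral domain of polynomials, avoids
    inverting [P]. *)
Lemma char_poly_similar (F : idomainType) n (P A D : 'M[F]_n) :
  \det P != 0 -> P *m A = D *m P -> char_poly A = char_poly D.
Proof.
move=> P0 PA; rewrite /char_poly.
have P0' : \det (map_mx polyC P) != 0 by rewrite det_map_mx polyC_eq0.
apply: (mulfI P0'); rewrite -det_mulmx [RHS]mulrC -det_mulmx /char_poly_mx.
by rewrite mulmxBr mulmxBl -!map_mxM PA -scalar_mxC.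
Qed.

Section SymmetricMatrix.
Variable R : rcfType.

Lemma row_normsq_gt0 n (u : 'rV[R]_n) : u != 0 -> 0 < (u *m u^T) 0 0.
Proof.
move=> u0; have uE : (u *m u^T) 0 0 = \sum_j u 0 j ^+ 2.
  by rewrite mxE; apply: eq_bigr => j _; rewrite [u^T _ _]mxE expr2.
rewrite lt_def uE sumr_ge0 ?andbT => [|j _]; last exact: sqr_ge0.
apply: contra u0; rewrite psumr_eq0 => [/allP u0|j _]; last exact: sqr_ge0.
apply/eqP/rowP => j; rewrite mxE; apply/eqP.
by have := u0 j (mem_index_enum j); rewrite /= sqrf_eq0.
Qed.

(* [Q] is the reflection in the hyperplane orthogonal to [v - e_0]. *)
Lemma orthogonal_row0 n (v : 'rV[R]_n.+1) : v *m v^T = 1%:M ->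
  exists2 Q : 'M[R]_n.+1, Q *m Q^T = 1%:M & row 0 Q = v.
Proof.
move=> vv; pose e : 'rV[R]_n.+1 := delta_mx 0 0.
have ee : e *m e^T = 1%:M.
  by rewrite /e trmx_delta mul_delta_mx; apply/matrixP=> i j; rewrite !mxE !ord1.
pose h := v - e.
have [h0|h0] := eqVneq h 0.
  exists 1%:M; first by rewrite trmx1 mulmx1.
  by rewrite rowE mulmx1; apply/esym/eqP; rewrite -subr_eq0; apply/eqP.
pose t := (h *m h^T) 0 0.
have hh : h *m h^T = t%:M by exact: mx11_scalar.
have t0 : t != 0 by rewrite gt_eqF ?row_normsq_gt0.
have vee : v *m e^T = (v 0 0)%:M.
  rewrite [LHS]mx11_scalar; congr (_%:M).
  by rewrite /e trmx_delta mxE (bigD1 0) //= big1 => [|k k0]; rewrite !mxE ?eqxx ?mulr1 ?addr0 // (negPf k0) mulr0.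
have eve : e *m v^T = (v 0 0)%:M by rewrite -[LHS]trmxK trmx_mul trmxK vee tr_scalar_mx.
(* As [v] and [e] are unit vectors, [t = |v - e|^2 = 2 - 2 v_0], so the reflection adds exactly [h]
   to [e] and yields [v]. *)
have eh : e *m h^T = (- (t / 2))%:M.
  have tE : t = 2 - 2 * v 0 0.
    have := hh; rewrite /h linearB /= mulmxBl !mulmxBr vv ee vee eve.
    move/(congr1 (fun A : 'M__ => A 0 0)); rewrite !mxE /= !mulr1n => <-.
    by ring.
  rewrite /h linearB /= mulmxBr eve ee -raddfB /=; congr (_%:M).
  by rewrite tE; field.
pose Q := 1%:M - (2 / t) *: (h^T *m h).
have QT : Q^T = Q.
  by rewrite /Q linearB /= trmx1 linearZ /= trmx_mul trmxK.
exists Q.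
  have XX : (h^T *m h) *m (h^T *m h) = t *: (h^T *m h).
    by rewrite mulmxA -(mulmxA h^T h) hh mul_mx_scalar -scalemxAl.
  rewrite QT /Q mulmxBr mulmx1 mulmxBl mul1mx -scalemxAl -scalemxAr XX !scalerA.
  rewrite -addrA -opprD -[RHS]subr0; congr (_ - _).
  rewrite -scalerBl -scalerDl (_ : _ + _ = 0) ?scale0r //; field; exact: t0.
rewrite rowE -/e /Q mulmxBr mulmx1 -scalemxAr mulmxA eh mul_scalar_mx scalerA.
rewrite (_ : _ * _ = -1); last by field.
by rewrite scaleN1r opprK /h addrC subrK.
Qed.

(** An eigenvalue exists over [R[i]]; symmetry makes it real, and a real eigenvalue of the
    complexified matrix is already one over [R]. *)
Lemma symmetric_eigenvector n (S : 'M[R]_n.+1) : S^T = S ->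
  exists a (v : 'rV[R]_n.+1), v *m v^T = 1%:M /\ v *m S = a *: v.
Proof.
move=> ST.
pose C : numClosedFieldType := R[i]%C.
pose f : {rmorphism R -> C} := real_complex R.
have [a] := @spectral.eigenvalue_closed C n.+1 (map_mx f S) isT.
case/eigenvalueP => u uS u0.
pose uc := map_mx (@Num.conj C) u.
pose N := u *m uc^T.
have fJ x : (Num.conj (f x) : C) = f x by exact: conjc_real.
have N0 : N 0 0 != 0.
  apply: contra u0 => /eqP; rewrite mxE => /eqP N0; apply/eqP/rowP => j.
  move: N0; rewrite psumr_eq0 => [|i _]; last by rewrite !mxE mul_conjC_ge0.
  move/allP/(_ j (mem_index_enum j)); rewrite !mxE mul_conjC_eq0 => /eqP //.
(* Evaluating [u S u^*] in two ways gives [a N] and the conjugate of [a] times [N]. *)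
have : Num.conj a = a.
  have ucS : uc *m map_mx f S = Num.conj a *: uc.
    rewrite -[uc *m _](_ : map_mx Num.conj (u *m map_mx f S) = _).
      by rewrite uS map_mxZ.
    rewrite map_mxM; congr (_ *m _); apply/matrixP => i j; rewrite !mxE.
    exact: fJ.
  have h1 : u *m map_mx f S *m uc^T = a *: N by rewrite uS -scalemxAl.
  have h2 : u *m map_mx f S *m uc^T = Num.conj a *: N.
    rewrite -mulmxA -[map_mx f S *m _]trmxK trmx_mul trmxK map_trmx ST ucS.
    by rewrite linearZ /= -scalemxAr.
  move: h2; rewrite h1 => /matrixP/(_ 0 0); rewrite mxE [RHS]mxE.
  by move=> /(mulIf N0) <-.
move/eqP; rewrite -CrealE => /complex_realP [b ab].
have eb : eigenvalue S b.
  rewrite -(eigenvalue_map f); apply/eigenvalueP; exists u => //.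
  by rewrite uS ab.
case/eigenvalueP: eb => v vS v0.
pose t := (v *m v^T) 0 0.
have t_gt0 : 0 < t by exact: row_normsq_gt0.
exists b, ((Num.sqrt t)^-1 *: v); split; last first.
  by rewrite -scalemxAl vS scalerA mulrC -scalerA.
rewrite linearZ /= -scalemxAl -scalemxAr (mx11_scalar (v *m v^T)) -/t scalerA.
rewrite scale_scalar_mx -invfM -expr2 sqr_sqrtr ?ltW // mulVf //.
by rewrite gt_eqF.
Qed.

(** Deflation: in an orthonormal basis starting with a unit eigenvector, symmetry makes the matrix
    block diagonal, and induction handles the lower right block. *)
Lemma symmetric_diagonalization n (S : 'M[R]_n) : S^T = S ->
  exists (P : 'M[R]_n) (d : 'rV[R]_n),
    P *m P^T = 1%:M /\ P *m S = diag_mx d *m P.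
Proof.
elim: n S => [|n IHn] S ST.
  by exists 1%:M, 0; split; apply/matrixP => -[].
have [a [v [vv vS]]] := @symmetric_eigenvector n S ST.
have [Q QQ Qv] := @orthogonal_row0 n v vv.
have QQ' : Q^T *m Q = 1%:M by exact: mulmx1C.
pose M : 'M_(1 + n) := Q *m S *m Q^T.
have MT : M^T = M by rewrite /M !trmx_mul trmxK ST mulmxA.
have Mr : row 0 M = a *: delta_mx 0 0.
  rewrite /M !row_mul Qv vS -scalemxAl; congr (_ *: _).
  by rewrite -Qv -row_mul QQ rowE mulmx1.
have Mur : ursubmx M = 0.
  apply/matrixP => i j; rewrite !mxE; move/rowP: Mr => /(_ (rshift 1 j)).
  rewrite !mxE ord1 (_ : lshift n (0 : 'I_1) = (0 : 'I_n.+1)); last exact: val_inj.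
  by move=> ->; rewrite mulr0.
have Mul : ulsubmx M = a%:M.
  apply/matrixP => i j; rewrite !mxE; move/rowP: Mr => /(_ (lshift n (0 : 'I_1))).
  rewrite !mxE !ord1 (_ : lshift n (0 : 'I_1) = (0 : 'I_n.+1)); last exact: val_inj.
  by move=> ->; rewrite mulr1.
have Mdl : dlsubmx M = 0 by rewrite -[dlsubmx M]trmxK trmx_dlsub MT Mur trmx0.
have [P' [d' [PP' PS']]] := IHn (drsubmx M) (etrans (trmx_drsub M) (congr1 _ MT)).
have ME : M = block_mx a%:M 0 0 (drsubmx M).
  by rewrite -[LHS]submxK Mul Mur Mdl.
pose P : 'M_(1 + n) := block_mx 1%:M 0 0 P'.
have PP : P *m P^T = 1%:M.
  rewrite /P (tr_block_mx 1%:M) mulmx_block !trmx0 !mulmx0 !mul0mx !addr0 add0r.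
  by rewrite PP' trmx1 mulmx1 -scalar_mx_block.
exists (P *m Q), (row_mx a%:M d'); split.
  by rewrite trmx_mul mulmxA -(mulmxA P) QQ mulmx1.
have -> : P *m Q *m S = P *m M *m Q by rewrite /M -!mulmxA QQ' mulmx1.
rewrite [RHS]mulmxA; congr (_ *m _).
rewrite [diag_mx _](diag_mx_row (a%:M : 'rV_1) d') ME /P !mulmx_block.
rewrite !mulmx0 !mul0mx !addr0 !add0r mul1mx PS' [RHS](@mulmx_block R 1 n 1 n 1 n).
rewrite !mulmx0 !mul0mx !addr0 !add0r mulmx1.
have -> // : diag_mx (a%:M : 'rV_1) = a%:M.
by apply/matrixP=> i j; rewrite !mxE !ord1.
Qed.

End SymmetricMatrix.

(** * Sorted spectra and eigenbases of self-adjoint operators *)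

Section Spectrum.
Variables (R : realType) (T : finType).
Implicit Types (m u v : T -> R) (L : (T -> R) -> (T -> R)).

Lemma sorted_flatten_nseq (f : R -> nat) (s : seq R) :
  sorted <%R s -> sorted <=%R (flatten [seq nseq (f x) x | x <- s]).
Proof.
rewrite lt_sorted_pairwise le_sorted_pairwise.
elim: s => //= x s IHs /andP[/allP xs /IHs ps].
rewrite pairwise_cat ps andbT; apply/andP; split; last first.
  by elim: (f x) => //= n ->; rewrite andbT; apply/allP => y /nseqP[->].
apply/allrelP => y z /nseqP[-> _] /flattenP[_ /mapP[t ts ->]] /nseqP[-> _].
exact/ltW/xs.
Qed.

Lemma spectrum_sorted L : sorted <=%R (spectrum L).
Proof. exact/sorted_flatten_nseq/sorted_roots. Qed.

(** Once the characteristic polynomial splits, the multiplicity of a root is its number of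
    occurrences in [d]. *)
Lemma spectrum_perm L (d : seq R) :
  char_poly (op_mx L) = \prod_(x <- d) ('X - x%:P) -> perm_eq (spectrum L) d.
Proof.
rewrite /spectrum => -> /=; set p := \prod_(x <- d) _.
have p0 : p != 0 by rewrite monic_neq0 // monic_prod_XsubC.
under eq_map do rewrite mu_prod_XsubC.
apply: perm_trans (perm_count_undup d).
apply/perm_flatten/perm_map/uniq_perm; rewrite ?undup_uniq //.
  exact: lt_sorted_uniq (sorted_roots _ _ _).
move=> x; rewrite mem_undup -[RHS]root_prod_XsubC -/p.
by rewrite -(roots_on_rootsR p0) in_itv.
Qed.

Definition wip m u v : R := \sum_x u x * v x * m x.

Lemma wipC m u v : wip m u v = wip m v u.
Proof. by apply: eq_bigr => x _; rewrite (mulrC (u x)). Qed.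

(** The two function spaces may differ, so as to cover the harmonic extension from the boundary to
    all vertices. *)
Definition linear_op (S : Type) (L : (T -> R) -> (S -> R)) :=
  forall a u v, L (fun y => a * u y + v y) =1 (fun x => a * L u x + L v x).

Lemma linear_op_sum (S : Type) (L : (T -> R) -> (S -> R)) (I : Type)
    (r : seq I) (c : I -> R) (u : I -> T -> R) x : linear_op L ->
  L (fun y => \sum_(i <- r) c i * u i y) x = \sum_(i <- r) c i * L (u i) x.
Proof.
move=> linL; elim: r => [|i r IHr].
  have -> : (fun y => \sum_(i <- [::]) c i * u i y) = fun=> 0.
    by apply/funext => y; rewrite big_nil.
  rewrite big_nil; have := linL (-1) (fun=> 0) (fun=> 0) x.
  rewrite (_ : (fun y => _) = fun=> 0); last first.
    by apply/funext => y; rewrite mulr0 addr0.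
  by move=> ->; rewrite mulN1r addNr.
by under eq_fun do rewrite big_cons; rewrite linL big_cons IHr.
Qed.

Lemma op_mxE L u (x : T) : linear_op L ->
  L u x = \sum_j op_mx L (enum_rank x) j * u (enum_val j).
Proof.
move=> linL.
have {1}-> : u = fun y => \sum_(j : 'I_#|T|) u (enum_val j) * (y == enum_val j)%:R.
  apply/funext => y; rewrite (bigD1 (enum_rank y)) //= enum_rankK eqxx mulr1.
  rewrite big1 ?addr0 // => j jy; rewrite (_ : _ == _ = false) ?mulr0 //.
  by apply: contra_neqF jy => /eqP->; rewrite enum_valK.
rewrite linear_op_sum //; apply: eq_bigr => j _.
by rewrite mxE enum_rankK mulrC.
Qed.

(** Positions in [e] start at 0 and the index of [eigval] at 1, whence the successors. *)
Record eigenbasis m L (e : 'I_#|T| -> T -> R) : Prop := Eigenbasis {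
  eigenbasis_ortho : forall i j, wip m (e i) (e j) = (i == j)%:R;
  eigenbasis_eigen : forall i x, L (e i) x = eigval L i.+1 * e i x;
  eigenbasis_total : forall u x, u x = \sum_i wip m u (e i) * e i x;
  eigenbasis_mono : forall i j : 'I_#|T|, (i <= j)%N ->
    eigval L i.+1 <= eigval L j.+1 }.

(** Conjugation by the square roots of the measure turns a self-adjoint operator into a symmetric
    matrix, whose orthonormal eigenvectors, divided by these roots, form the basis. *)
Lemma eigenbasis_exists m L : (forall x, 0 < m x) -> linear_op L ->
  (forall u v, wip m (L u) v = wip m u (L v)) ->
  exists e, eigenbasis m L e.
Proof.
move=> m_gt0 linL adjL; pose n := #|T|.
pose r (x : T) := Num.sqrt (m x).
have r0 x : r x != 0 by rewrite gt_eqF // sqrtr_gt0.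
have rr x : r x * r x = m x by rewrite -expr2 sqr_sqrtr ?ltW.
pose M := op_mx L; pose ev := @enum_val T T.
have MM i j : M i j * m (ev i) = M j i * m (ev j).
  have wd u i0 : wip m u (fun y => (y == ev i0)%:R) = u (ev i0) * m (ev i0).
    rewrite /wip (bigD1 (ev i0)) //= eqxx mulr1 big1 ?addr0 // => y /negPf->.
    by rewrite mulr0 mul0r.
  have := adjL (fun y => (y == ev j)%:R) (fun y => (y == ev i)%:R).
  by rewrite wd wipC wd /M !mxE.
pose S : 'M[R]_n := \matrix_(i, j) (r (ev i) * M i j / r (ev j)).
have ST : S^T = S.
  apply/matrixP => i j; rewrite [LHS]mxE [LHS]mxE [RHS]mxE.
  apply/eqP; rewrite eqr_div //; apply/eqP.
  by rewrite mulrAC rr (mulrAC (r (ev i))) rr mulrC -MM mulrC.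
have [P [d [PP PS]]] := symmetric_diagonalization ST.
have PP' : P^T *m P = 1%:M by exact: mulmx1C.
pose g k x := P k (enum_rank x) / r x.
have Mg k x : L (g k) x = d 0 k * g k x.
  rewrite op_mxE //; set i := enum_rank x.
  have := congr1 (fun A : 'M__ => A k i) PS; rewrite mul_diag_mx mxE [RHS]mxE.
  rewrite /g -/i mulrA => <-; rewrite mulr_suml; apply: eq_bigr => j _.
  rewrite -ST !mxE enum_valK /ev enum_rankK -/M.
  by field; rewrite !r0.
have cM : char_poly M = \prod_(x <- [tuple d 0 k | k < n]) ('X - x%:P).
  rewrite (@char_poly_similar _ _ (P *m diag_mx (\row_i r (ev i))) M (diag_mx d)).
  - rewrite char_poly_trig ?diag_mx_is_trig // big_tuple.
    by apply: eq_bigr => i _; rewrite tnth_mktuple mxE eqxx mulr1n.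
  - rewrite det_mulmx mulf_neq0 //.
      have : \det P * \det P^T = 1 by rewrite -det_mulmx PP det1.
      by apply: contra_eq_neq => ->; rewrite mul0r eq_sym oner_eq0.
    by rewrite det_diag; apply/prodf_neq0 => i _; rewrite mxE.
  - rewrite [RHS]mulmxA -PS -!mulmxA; congr (_ *m _).
    apply/matrixP => i j; rewrite mul_diag_mx mul_mx_diag !mxE divfK //.
(* The entries of [d] come in no particular order; [p] matches them with the sorted spectrum. *)
have /tuple_permP[p sE] := spectrum_perm cM.
have dE (i : 'I_n) : eigval L i.+1 = d 0 (p i).
  by rewrite /eigval sE /= (nth_map i) ?size_enum_ord // nth_ord_enum tnth_mktuple.
have gortho k l : wip m (g k) (g l) = (k == l)%:R.
  have -> : (k == l)%:R = (P *m P^T) k l by rewrite PP mxE.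
  rewrite mxE /wip (reindex _ (onW_bij _ (@enum_val_bij T))) /=.
  apply: eq_bigr => j _.
  by rewrite /g enum_valK !mxE -rr; field; exact: r0.
exists (fun i => g (p i)); split.
- by move=> i j; rewrite gortho (inj_eq perm_inj).
- by move=> i x; rewrite dE Mg.
- move=> u x.
  rewrite -(@reindex_inj _ _ _ _ _ xpredT (fun k => wip m u (g k) * g k x)
    (@perm_inj _ p)) /=.
  under eq_bigr => k _ do rewrite mulr_suml.
  rewrite exchange_big /=.
  (* Completeness of the basis is orthonormality of the columns of [P], as [gortho] is that of its
     rows. *)
  have PPyx y : \sum_k P k (enum_rank y) * P k (enum_rank x) = (y == x)%:R.
    have := congr1 (fun A : 'M__ => A (enum_rank y) (enum_rank x)) PP'.
    rewrite !mxE (inj_eq enum_rank_inj) => <-; apply: eq_bigr => k _.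
    by rewrite mxE.
  rewrite [RHS](eq_bigr (fun y => u y * (r y / r x) * (y == x)%:R)).
    rewrite (bigD1 x) //= eqxx divff // !mulr1 big1 ?addr0 // => y /negPf->.
    by rewrite mulr0.
  move=> y _; rewrite -PPyx mulr_sumr; apply: eq_bigr => k _.
  rewrite /g -rr; field; rewrite !r0 //.
- move=> i j ij; rewrite /eigval.
  apply: (sorted_leq_nth le_trans le_refl _ (spectrum_sorted L)) => //=;
  by rewrite inE sE size_tuple.
Qed.

End Spectrum.

(** * Rayleigh quotients and coordinates in an eigenbasis *)

Section EigenbasisTheory.
Variables (R : realType) (T : finType).
Implicit Types (m u v : T -> R) (L : (T -> R) -> (T -> R)).

Lemma wip_suml m (I : Type) (r : seq I) (a : I -> R) (u : I -> T -> R) v :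
  wip m (fun x => \sum_(i <- r) a i * u i x) v = \sum_(i <- r) a i * wip m (u i) v.
Proof.
rewrite /wip; under eq_bigr do rewrite !mulr_suml.
rewrite exchange_big /=; apply: eq_bigr => i _; rewrite mulr_sumr.
by apply: eq_bigr => x _; rewrite !mulrA.
Qed.

Lemma wip_ge0 m u : (forall x, 0 < m x) -> 0 <= wip m u u.
Proof.
by move=> m_gt0; apply: sumr_ge0 => x _; rewrite -expr2 mulr_ge0 ?sqr_ge0 ?ltW.
Qed.

Lemma wip_eq0 m u : (forall x, 0 < m x) -> wip m u u = 0 -> forall x, u x = 0.
Proof.
move=> m_gt0 /eqP; rewrite psumr_eq0 => [/allP u0 x|x _]; last first.
  by rewrite -expr2 mulr_ge0 ?sqr_ge0 ?ltW.
have := u0 x (mem_index_enum x).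
by rewrite /= mulf_eq0 (gt_eqF (m_gt0 x)) orbF -expr2 sqrf_eq0 => /eqP.
Qed.

(** Injectivity makes the square matrix of [L] invertible; this derives existence of harmonic
    extensions from their uniqueness. *)
Lemma linear_op_surj L : linear_op L -> (forall u, L u =1 (fun=> 0) -> u =1 (fun=> 0)) ->
  forall b, exists u, L u =1 b.
Proof.
move=> linL injL b; pose M := op_mx L.
have Mu : M \in unitmx.
  rewrite unitmxE unitfE -det_tr; apply/det0P => -[v v0 vM].
  have /injL v_eq0 : L (fun x => v 0 (enum_rank x)) =1 (fun=> 0).
    move=> x; rewrite op_mxE //.
    transitivity ((v *m M^T) 0 (enum_rank x)); last by rewrite vM mxE.
    rewrite mxE; apply: eq_bigr => j _.
    by rewrite enum_valK [M^T _ _]mxE mulrC.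
  case/eqP: v0; apply/rowP => j; rewrite mxE -(enum_valK j); exact: v_eq0.
pose bv : 'cV[R]_#|T| := \col_i b (enum_val i).
exists (fun x => (invmx M *m bv) (enum_rank x) 0) => x.
transitivity ((M *m (invmx M *m bv)) (enum_rank x) 0); last first.
  by rewrite mulKVmx // mxE enum_rankK.
rewrite op_mxE // mxE.
by apply: eq_bigr => j _; rewrite enum_valK.
Qed.

Variables (m : T -> R) (L : (T -> R) -> (T -> R)) (e : 'I_#|T| -> T -> R).
Hypotheses (linL : linear_op L) (eb : eigenbasis m L e).
Implicit Types w : T -> R.

Lemma eigenbasis_op w x :
  L w x = \sum_i wip m w (e i) * (eigval L i.+1 * e i x).
Proof.
rewrite {1}(_ : w = fun x => \sum_i wip m w (e i) * e i x).
  by rewrite linear_op_sum //; apply: eq_bigr => i _; rewrite (eigenbasis_eigen eb).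
by apply/funext => y; exact: eigenbasis_total eb _ _.
Qed.

Lemma parseval w v : wip m w v = \sum_i wip m w (e i) * wip m (e i) v.
Proof.
rewrite {1}(_ : w = fun x => \sum_i wip m w (e i) * e i x) ?wip_suml //.
by apply/funext => y; exact: eigenbasis_total eb _ _.
Qed.

(** Both Rayleigh bounds and their equality cases are read off from the signs of these summands. *)
Lemma rayleigh_defect w a :
  wip m (L w) w - a * wip m w w = \sum_(i < #|T|) (eigval L i.+1 - a) * wip m w (e i) ^+ 2.
Proof.
have {1}-> : L w = fun x => \sum_i (wip m w (e i) * eigval L i.+1) * e i x.
  apply/funext => x; rewrite eigenbasis_op.
  by apply: eq_bigr => i _; rewrite mulrA.
rewrite wip_suml parseval mulr_sumr -sumrB; apply: eq_bigr => i _.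
by rewrite (wipC _ (e i)); ring.
Qed.

Lemma rayleigh_eigen w a :
  (forall i : 'I_#|T|, (eigval L i.+1 - a) * wip m w (e i) ^+ 2 = 0) ->
  L w =1 (fun x => a * w x).
Proof.
move=> wa x; rewrite eigenbasis_op [w x in RHS](eigenbasis_total eb) mulr_sumr.
apply: eq_bigr => i _; have /eqP := wa i.
rewrite mulf_eq0 subr_eq0 sqrf_eq0 => /orP[/eqP->|/eqP->]; last by rewrite !mul0r mulr0.
by rewrite mulrCA.
Qed.

(** With no component below [a], every term of [rayleigh_defect] is nonnegative; equality kills each
    term, so only components in the eigenspace of [a] remain. *)
Lemma rayleigh_ge w a : (forall i : 'I_#|T|, eigval L i.+1 < a -> wip m w (e i) = 0) ->
  a * wip m w w <= wip m (L w) w /\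
  (wip m (L w) w = a * wip m w w -> L w =1 (fun x => a * w x)).
Proof.
move=> wa.
have ge0 (i : 'I_#|T|) : 0 <= (eigval L i.+1 - a) * wip m w (e i) ^+ 2.
  have [/wa->|ai] := ltP (eigval L i.+1) a; first by rewrite expr0n mulr0.
  by rewrite mulr_ge0 ?sqr_ge0 // subr_ge0.
split; first by rewrite -subr_ge0 rayleigh_defect sumr_ge0.
move=> /eqP; rewrite -subr_eq0 rayleigh_defect psumr_eq0 // => /allP h.
by apply: rayleigh_eigen => i; apply/eqP/h/mem_index_enum.
Qed.

Lemma rayleigh_le w a : (forall i : 'I_#|T|, a < eigval L i.+1 -> wip m w (e i) = 0) ->
  wip m (L w) w <= a * wip m w w /\
  (wip m (L w) w = a * wip m w w -> L w =1 (fun x => a * w x)).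
Proof.
move=> wa.
have ge0 (i : 'I_#|T|) : 0 <= - ((eigval L i.+1 - a) * wip m w (e i) ^+ 2).
  have [/wa->|ai] := ltP a (eigval L i.+1); first by rewrite expr0n mulr0 oppr0.
  by rewrite -mulNr mulr_ge0 ?sqr_ge0 // opprB subr_ge0.
split; first by rewrite -subr_ge0 -opprB rayleigh_defect -sumrN sumr_ge0.
move=> /eqP; rewrite -subr_eq0 -oppr_eq0 rayleigh_defect -sumrN psumr_eq0 // => /allP h.
apply: rayleigh_eigen => i; apply/eqP; rewrite -oppr_eq0.
exact/h/mem_index_enum.
Qed.

Lemma eigenbasis_coord w j :
  wip m (L w) (e j) = eigval L j.+1 * wip m w (e j).
Proof.
have -> : L w = fun x => \sum_i (wip m w (e i) * eigval L i.+1) * e i x.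
  apply/funext => x; rewrite eigenbasis_op.
  by apply: eq_bigr => i _; rewrite mulrA.
rewrite wip_suml (bigD1 j) //= big1 => [|i ij]; rewrite (eigenbasis_ortho eb).
  by rewrite eqxx addr0 mulr1 mulrC.
by rewrite (negPf ij) mulr0.
Qed.

Lemma eigenbasis_neq0 i : exists x, e i x != 0.
Proof.
apply: contrapT => h; have := eigenbasis_ortho eb i i; rewrite eqxx /wip big1.
  by move/eqP; rewrite eq_sym oner_eq0.
move=> x _; suff -> : e i x = 0 by rewrite !mul0r.
by apply: contrapT => ex; apply: h; exists x; apply/eqP.
Qed.

Hypothesis L1 : L (fun=> 1) =1 (fun=> 0).
Hypothesis L_gt0 : forall i : 'I_#|T|, (0 < i)%N -> 0 < eigval L i.+1.

(** Eigenfunctions with positive eigenvalue are orthogonal to the kernel, which contains the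
    constants. Here [L] stands for both [neg_laplacian] and [DtN]. *)
Lemma const_coord (i : 'I_#|T|) : (0 < i)%N -> wip m (fun=> 1) (e i) = 0.
Proof.
move=> i0; have := eigenbasis_coord (fun=> 1) i.
rewrite /wip big1 => [|x _]; last by rewrite L1 !mul0r.
by move/esym/eqP; rewrite mulf_eq0 (gt_eqF (L_gt0 i0)) => /eqP.
Qed.

Lemma const_coord0 (i : 'I_#|T|) : i = 0%N :> nat -> wip m (fun=> 1) (e i) != 0.
Proof.
move=> i0; have [x _] := eigenbasis_neq0 i.
apply/eqP => c0; have := eigenbasis_total eb (fun=> 1) x; rewrite big1.
  by move/eqP; rewrite oner_eq0.
move=> j _; have [j0|/const_coord->] := posnP j; last by rewrite mul0r.
by rewrite (_ : j = i) ?c0 ?mul0r //; apply: val_inj; rewrite /= j0.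
Qed.

Lemma eigval1_eq0 (i : 'I_#|T|) : i = 0%N :> nat -> eigval L i.+1 = 0.
Proof.
move=> i0; have := eigenbasis_coord (fun=> 1) i.
rewrite {1}/wip big1 => [|x _]; last by rewrite L1 !mul0r.
by move/esym/eqP; rewrite mulf_eq0 (negPf (const_coord0 i0)) orbF => /eqP.
Qed.

(** The constant has only its first coordinate nonzero, so Parseval reduces [wip m w 1] to a nonzero
    multiple of the first coordinate of [w]. *)
Lemma ortho_const w (i : 'I_#|T|) :
  wip m w (fun=> 1) = 0 -> i = 0%N :> nat -> wip m w (e i) = 0.
Proof.
move=> w1 i0; have := w1; rewrite parseval (bigD1 i) //= big1 ?addr0 => [|j ji].
  move/eqP; rewrite mulf_eq0 [wip m (e i) _]wipC (negPf (const_coord0 i0)) orbF.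
  by move/eqP.
rewrite (wipC _ (e j)) const_coord ?mulr0 // lt0n -i0.
by apply: contra ji => /eqP ji; apply/eqP/val_inj.
Qed.

End EigenbasisTheory.

(** There are [k] equations in [k.+1] unknowns: the dimension count behind [test_function]. *)
Lemma nontrivial_relation (F : fieldType) k (A : 'I_k.+1 -> 'I_k -> F) :
  exists c : 'I_k.+1 -> F,
    (exists i, c i != 0) /\ forall j, \sum_i c i * A i j = 0.
Proof.
pose M : 'M[F]_(k.+1, k) := \matrix_(i, j) A i j.
have : kermx M != 0.
  rewrite kermx_eq0 /row_free neq_ltn; apply/orP; left.
  exact: leq_ltn_trans (rank_leq_col M) _.
case/rowV0Pn => v /sub_kermxP vM v0; exists (v 0); split.
  apply: contrapT => h; case/eqP: v0; apply/rowP => i; rewrite mxE.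
  by apply: contrapT => vi; apply: h; exists i; apply/eqP.
move=> j; transitivity ((v *m M) 0 j); last by rewrite vM mxE.
by rewrite mxE; apply: eq_bigr => i _; rewrite mxE.
Qed.

(** * Weighted graphs and the Dirichlet-to-Neumann map *)

Section GraphOperators.
Variables (R : realType) (V : finType) (E : rel V) (m : V -> R) (w : V -> V -> R).
Variable (B : {set V}).
Hypothesis hG : weighted_graph E m w.
Hypothesis hB : graph_boundary E B.
Implicit Types (u v : V -> R) (f g : bvertex B -> R).

Let m_gt0 x : 0 < m x. Proof. by case: hG => _ []. Qed.
Let m_neq0 x : m x != 0. Proof. by rewrite gt_eqF. Qed.
Let wC x y : w x y = w y x. Proof. by case: hG => _ []. Qed.
Let w_gt0 x y : E x y -> 0 < w x y. Proof. by case: hG => _ [] _ _ + _; apply. Qed.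
Let w_eq0 x y : ~~ E x y -> w x y = 0. Proof. by case: hG => _ [] _ _ _; apply. Qed.

Lemma weight_ge0 x y : 0 <= w x y.
Proof. by have [/w_gt0/ltW|/w_eq0->] := boolP (E x y). Qed.

Lemma sum_vertices (F : V -> R) :
  \sum_x F x = \sum_(x : bvertex B) F (val x) + \sum_(y : interior B) F (val y).
Proof.
rewrite (bigID (mem B)) /=; congr (_ + _); first exact: big_sub.
exact: (big_sub [pred y | y \notin B]).
Qed.

Lemma normal_derivE u x : normal_deriv m w u x = neg_laplacian m w u x.
Proof.
rewrite /neg_laplacian /laplacian -mulrN -sumrN; congr (_ * _).
by apply: eq_bigr => y _; rewrite -mulNr opprB.
Qed.

Lemma laplacian_linear : linear_op (laplacian m w).
Proof.
move=> a u v x; rewrite /laplacian mulrCA -mulrDr; congr (_ * _).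
by rewrite mulr_sumr -big_split; apply: eq_bigr => y _ /=; ring.
Qed.

Lemma neg_laplacian_linear : linear_op (neg_laplacian m w).
Proof.
by move=> a u v x; rewrite /neg_laplacian laplacian_linear opprD mulrN.
Qed.

Definition dirichlet u v : R :=
  2^-1 * \sum_x \sum_y (u x - u y) * (v x - v y) * w x y.

Lemma green u v : wip m (neg_laplacian m w u) v = dirichlet u v.
Proof.
have -> : wip m (neg_laplacian m w u) v = \sum_x \sum_y (u x - u y) * v x * w x y.
  apply: eq_bigr => x _; rewrite -normal_derivE /normal_deriv.
  transitivity ((\sum_y (u x - u y) * w x y) * v x); first by field; exact: m_neq0.
  by rewrite mulr_suml; apply: eq_bigr => y _; rewrite mulrAC.
set A := LHS.
(* Exchanging [x] and [y], with [w] symmetric, replaces [v x] by [- v y]; averaging the two forms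
   gives the Dirichlet form. *)
have AE : A = \sum_x \sum_y (u x - u y) * - v y * w x y.
  rewrite /A exchange_big; apply: eq_bigr => x _; apply: eq_bigr => y _.
  by rewrite wC; ring.
have AA : A + A = \sum_x \sum_y (u x - u y) * (v x - v y) * w x y.
  rewrite {2}AE -big_split; apply: eq_bigr => x _.
  by rewrite -big_split; apply: eq_bigr => y _ /=; ring.
by rewrite /dirichlet -AA; field.
Qed.

Lemma dirichlet_ge0 u : 0 <= dirichlet u u.
Proof.
rewrite mulr_ge0 ?invr_ge0 ?ler0n //; apply: sumr_ge0 => x _; apply: sumr_ge0 => y _.
by rewrite mulr_ge0 ?weight_ge0 // -expr2 sqr_ge0.
Qed.

(** Every edge term vanishes, so [u] is constant along edges, and connectedness does the rest. *)
Lemma dirichlet_eq0 u : dirichlet u u = 0 -> forall x y, u x = u y.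
Proof.
have term_ge0 x y : 0 <= (u x - u y) * (u x - u y) * w x y.
  by rewrite mulr_ge0 ?weight_ge0 // -expr2 sqr_ge0.
move/eqP; rewrite mulf_eq0 invr_eq0 pnatr_eq0 /= psumr_eq0 => [/allP u0|x _]; last first.
  exact: sumr_ge0.
have uE x y : E x y -> u x = u y.
  move=> Exy; have := u0 x (mem_index_enum x); rewrite /= psumr_eq0 //.
  move/allP/(_ y (mem_index_enum y)).
  rewrite /= mulf_eq0 (gt_eqF (w_gt0 Exy)) orbF -expr2 sqrf_eq0 subr_eq0.
  by move/eqP.
move=> x y; case: hG => -[_ _ /(_ x y) /connectP[p xp ->]] _.
elim: p x xp => //= z p IHp x /andP[/uE-> zp]; exact: IHp.
Qed.

Lemma boundary_vertex : exists x, x \in B.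
Proof. by apply/set0Pn; case: hB. Qed.

Lemma dirichlet_interior u : (forall y, y \notin B -> laplacian m w u y = 0) ->
  forall v, dirichlet u v =
    wip (fun x : bvertex B => m (val x))
      (fun x => normal_deriv m w u (val x)) (fun x => v (val x)).
Proof.
move=> uh v; rewrite -green /wip sum_vertices [X in _ + X]big1 ?addr0.
  by apply: eq_bigr => x _; rewrite normal_derivE.
by move=> y _; rewrite /neg_laplacian uh ?oppr0 ?mul0r // (valP y).
Qed.

(** By Green's formula the energy of [u] is zero, so [u] is constant, equal to its value 0 at some
    boundary vertex. *)
Lemma harmonic_eq0 u : (forall x, x \in B -> u x = 0) ->
  (forall y, y \notin B -> laplacian m w u y = 0) -> forall x, u x = 0.
Proof.
move=> uB uI x; have [b bB] := boundary_vertex.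
rewrite -(uB _ bB); apply: dirichlet_eq0.
rewrite dirichlet_interior // /wip big1 // => y _.
by rewrite uB ?mulr0 ?mul0r // (valP y).
Qed.

Lemma harmonic_ext_exists f : exists u, is_harmonic_ext m w f u.
Proof.
(* The boundary value problem as one square system: identity on [B], Laplacian on the interior. Its
   right-hand side is [f] extended by 0. *)
pose L u x := if x \in B then u x else laplacian m w u x.
have linL : linear_op L.
  move=> a u v x; rewrite /L; case: ifP => // _; exact: laplacian_linear.
have injL u : L u =1 (fun=> 0) -> u =1 (fun=> 0).
  move=> Lu; apply: harmonic_eq0 => x xB; have := Lu x; rewrite /L.
    by rewrite xB.
  by rewrite (negPf xB).
have [u uE] := linear_op_surj linL injL (fun x => oapp f 0 (insub x)).
exists u; split=> [x|y].
  by have := uE (val x); rewrite /L (valP x) valK.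
have := uE (val y); rewrite /L (negPf (valP y)) insubF //.
exact/negbTE/(valP y).
Qed.

Lemma harmonic_extP f : is_harmonic_ext m w f (harmonic_ext m w f).
Proof. by have [u] := harmonic_ext_exists f; exact: xgetI. Qed.

Lemma harmonic_ext_boundary f (x : bvertex B) : harmonic_ext m w f (val x) = f x.
Proof. by case: (harmonic_extP f). Qed.

Lemma harmonic_ext_interior f y : y \notin B -> laplacian m w (harmonic_ext m w f) y = 0.
Proof. by case: (harmonic_extP f) => _ + yB => /(_ (Sub y yB)). Qed.

Lemma harmonic_ext_unique f u : is_harmonic_ext m w f u -> u =1 harmonic_ext m w f.
Proof.
move=> [uB uI] x; apply/eqP; rewrite -subr_eq0 addrC -mulN1r; apply/eqP.
apply: (@harmonic_eq0 (fun y => -1 * harmonic_ext m w f y + u y)) => [y yB|y yB].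
  by rewrite -[y]/(val (Sub y yB : bvertex B)) harmonic_ext_boundary uB mulN1r addNr.
rewrite laplacian_linear harmonic_ext_interior // mulr0 add0r.
exact: (uI (Sub y yB)).
Qed.

Lemma harmonic_ext_linear : linear_op (@harmonic_ext R V m w B).
Proof.
move=> a f g x; apply/esym.
apply: (@harmonic_ext_unique _ (fun x => a * harmonic_ext m w f x + harmonic_ext m w g x)).
split=> [y|y]; first by rewrite !harmonic_ext_boundary.
by rewrite laplacian_linear !harmonic_ext_interior ?mulr0 ?addr0 // (valP y).
Qed.

Lemma DtN_linear : linear_op (@DtN R V m w B).
Proof.
move=> a f g x; rewrite /DtN !normal_derivE.
rewrite (_ : harmonic_ext m w _ = fun x =>
  a * harmonic_ext m w f x + harmonic_ext m w g x) ?neg_laplacian_linear //.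
by apply/funext => y; exact: harmonic_ext_linear.
Qed.

Local Notation mB := (fun x : bvertex B => m (val x)).

(** This makes [DtN] self-adjoint and nonnegative, and ties its Rayleigh quotient to that of the
    Laplacian at the extension. *)
Lemma DtN_dirichlet f g :
  wip mB (DtN m w f) g = dirichlet (harmonic_ext m w f) (harmonic_ext m w g).
Proof.
rewrite dirichlet_interior; last exact: harmonic_ext_interior.
by apply: eq_bigr => x _; rewrite harmonic_ext_boundary.
Qed.

Lemma dirichletC u v : dirichlet u v = dirichlet v u.
Proof.
by congr (_ * _); apply: eq_bigr => x _; apply: eq_bigr => y _; rewrite (mulrC (u x - _)).
Qed.

Lemma laplacian_eigenbasis : exists e, eigenbasis m (neg_laplacian m w) e.
Proof.
apply: eigenbasis_exists => //; first exact: neg_laplacian_linear.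
by move=> u v; rewrite green dirichletC -green wipC.
Qed.

Lemma DtN_eigenbasis : exists e, eigenbasis mB (@DtN R V m w B) e.
Proof.
apply: eigenbasis_exists => //; first exact: DtN_linear.
by move=> f g; rewrite DtN_dirichlet dirichletC -DtN_dirichlet wipC.
Qed.

Lemma wip_split u v : wip m u v =
  wip mB (fun x => u (val x)) (fun x => v (val x)) +
  inner_int m (fun y : interior B => u (val y)) (fun y => v (val y)).
Proof. exact: sum_vertices. Qed.

Lemma neg_laplacian_const (c : R) x : neg_laplacian m w (fun=> c) x = 0.
Proof.
rewrite /neg_laplacian /laplacian big1 ?mulr0 ?oppr0 // => y _.
by rewrite subrr mul0r.
Qed.

End GraphOperators.

(** * Comparison of the two spectra *)

Section Comparison.
Variables (R : realType) (V : finType) (E : rel V) (m : V -> R) (w : V -> V -> R).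
Variable (B : {set V}).
Hypothesis hG : weighted_graph E m w.
Hypothesis hB : graph_boundary E B.
Variables (e : 'I_#|V| -> V -> R) (phi : 'I_#|bvertex B| -> bvertex B -> R).
Local Notation mB := (fun x : bvertex B => m (val x)).
Local Notation ext := (@harmonic_ext R V m w B).
Hypothesis eb : eigenbasis m (neg_laplacian m w) e.
Hypothesis phib : eigenbasis mB (@DtN R V m w B) phi.
Implicit Types (u v : V -> R) (f g : bvertex B -> R).

Let m_gt0 x : 0 < m x. Proof. by case: hG => _ []. Qed.
Let linN := @neg_laplacian_linear R V m w.
Let linD := DtN_linear hG hB.
Let linE := harmonic_ext_linear hG hB.

Lemma wip_ext f : wip m (ext f) (ext f) = wip mB f f +
  inner_int m (fun y : interior B => ext f (val y)) (fun y => ext f (val y)).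
Proof.
rewrite (wip_split m B); congr (_ + _); apply: eq_bigr => x _.
by rewrite (harmonic_ext_boundary hG hB).
Qed.

Lemma ext_sum f x : ext f x = \sum_i wip mB f (phi i) * ext (phi i) x.
Proof.
rewrite -linear_op_sum //; congr (ext _ x); apply/funext => y.
exact: eigenbasis_total phib _ _.
Qed.

(** The span of the first [k.+1] Steklov eigenfunctions has room for [k] linear conditions. The
    family [g] is left free: the equality case mixes Laplacian eigenfunctions with extensions of
    Steklov ones. *)
Lemma test_function (k : 'I_#|bvertex B|) (g : 'I_k -> V -> R) :
  exists f, [/\ exists x, f x != 0, forall j, wip m (ext f) (g j) = 0 &
    forall i : 'I_#|bvertex B|, (k < i)%N -> wip mB f (phi i) = 0].
Proof.
pose p i := phi (widen_ord (ltn_ord k) i).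
have [c [[i0 ci0] cA]] := nontrivial_relation (fun i j => wip m (ext (p i)) (g j)).
exists (fun x => \sum_i c i * p i x).
have coord i : wip mB (fun x => \sum_i c i * p i x) (phi i) =
    \sum_j c j * (widen_ord (ltn_ord k) j == i)%:R.
  by rewrite wip_suml; apply: eq_bigr => j _; rewrite (eigenbasis_ortho phib).
split.
- apply: contrapT => h; have := coord (widen_ord (ltn_ord k) i0).
  rewrite /wip big1 => [|x _]; last first.
    suff -> : \sum_i c i * p i x = 0 by rewrite !mul0r.
    by apply: contrapT => fx; apply: h; exists x; apply/eqP.
  rewrite (bigD1 i0) //= eqxx mulr1 big1 ?addr0 => [|j ji0].
    by move/esym/eqP; rewrite (negPf ci0).
  rewrite (_ : _ == _ = false) ?mulr0 //; apply: contraNF ji0 => /eqP ji0.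
  by apply/eqP/val_inj; exact: (congr1 val ji0).
- move=> j; rewrite (_ : ext _ = fun x => \sum_i c i * ext (p i) x).
    by rewrite wip_suml cA.
  by apply/funext => x; rewrite linear_op_sum.
- move=> i ki; rewrite coord big1 // => j _.
  rewrite (_ : _ == _ = false) ?mulr0 //; apply/negbTE; apply: contraL ki => /eqP<-.
  by rewrite -leqNgt; exact: (ltn_ord j).
Qed.

(** Orthogonality to [e i] is asked only when its eigenvalue is strictly below that of index [k];
    this freedom lets the equality case spend the other conditions elsewhere. *)
Lemma squeeze (k : 'I_#|bvertex B|) f :
  (exists x, f x != 0) ->
  (forall i : 'I_#|V|, mu m w i.+1 < mu m w k.+1 -> wip m (ext f) (e i) = 0) ->
  (forall i : 'I_#|bvertex B|, (k < i)%N -> wip mB f (phi i) = 0) ->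
  mu m w k.+1 <= sigma m w B k.+1 /\
  (0 < mu m w k.+1 -> sigma m w B k.+1 = mu m w k.+1 ->
    [/\ forall y, y \notin B -> ext f y = 0,
        neg_laplacian m w (ext f) =1 (fun x => mu m w k.+1 * ext f x) &
        DtN m w f =1 (fun x => sigma m w B k.+1 * f x)]).
Proof.
move=> [x0 fx0] mu0 sg0; set M := mu _ _ _ in mu0 *; set S := sigma _ _ _ _.
have [geM eqM] := rayleigh_ge linN eb mu0.
have [leS eqS] : wip mB (DtN m w f) f <= S * wip mB f f /\
    (wip mB (DtN m w f) f = S * wip mB f f -> DtN m w f =1 (fun x => S * f x)).
  apply: (rayleigh_le linD phib) => i; rewrite /S /sigma => lt; apply: sg0.
  rewrite ltnNge; apply: contraL lt => ik; rewrite -leNgt.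
  exact: (eigenbasis_mono phib).
set Nf := wip mB f f in leS eqS *; set Nu := wip m (ext f) (ext f) in geM eqM.
have Nf_gt0 : 0 < Nf.
  rewrite lt_def wip_ge0 // andbT; apply: contra fx0 => /eqP Nf0.
  by apply/eqP; exact: wip_eq0 Nf0 x0.
pose I := inner_int m (fun y : interior B => ext f (val y)) (fun y => ext f (val y)).
have NuE : Nu = Nf + I by rewrite /Nu wip_ext.
have mI_gt0 (y : interior B) : 0 < m (val y) by [].
have I_ge0 : 0 <= I by exact: (@wip_ge0 _ _ (fun y : interior B => m (val y))).
have qE : wip mB (DtN m w f) f = wip m (neg_laplacian m w (ext f)) (ext f).
  by rewrite (DtN_dirichlet hG hB) (green hG).
have S_ge0 : 0 <= S.
  rewrite -(pmulr_lge0 _ Nf_gt0); apply: le_trans leS.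
  by rewrite (DtN_dirichlet hG hB) (dirichlet_ge0 hG).
rewrite -qE in geM eqM; rewrite NuE in geM eqM.
have MS : M * (Nf + I) <= S * Nf by exact: le_trans leS.
split.
  have [//|SM] := leP M S; have : S * Nf < M * (Nf + I).
    apply: lt_le_trans (_ : M * Nf <= _); first by rewrite ltr_pM2r.
    by rewrite ler_wpM2l ?lerDl // (le_trans S_ge0) // ltW.
  by rewrite ltNge MS.
move=> M_gt0 SM.
(* With [S = M], the chain [M * (Nf + I) <= S * Nf] leaves [M * I <= 0]. *)
have I0 : I = 0.
  apply/eqP; rewrite eq_le I_ge0 andbT -(pmulr_rle0 _ M_gt0).
  by move: MS; rewrite SM mulrDr gerDl.
rewrite I0 addr0 in geM eqM.
have qS : wip mB (DtN m w f) f = M * Nf.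
  by apply/eqP; rewrite eq_le geM andbT -SM.
split; [|exact: eqM|by apply: eqS; rewrite SM].
move=> y yB; exact: (@wip_eq0 _ _ _ (fun y : interior B => ext f (val y)) mI_gt0 I0 (Sub y yB)).
Qed.

Lemma card_boundary_le : (#|bvertex B| <= #|V|)%N.
Proof. by rewrite card_sig max_card. Qed.

Lemma mu_le_sigma_ord (k : 'I_#|bvertex B|) :
  mu m w k.+1 <= sigma m w B k.+1 /\
  (0 < mu m w k.+1 -> sigma m w B k.+1 = mu m w k.+1 ->
    exists v, [/\ eigenfunction (neg_laplacian m w) (mu m w k.+1) v,
       forall y, y \notin B -> v y = 0 &
       forall y, y \notin B -> laplacian m w v y = 0]).
Proof.
have kV : (k < #|V|)%N by exact: leq_trans (ltn_ord k) card_boundary_le.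
have [f [f0 fg fphi]] := test_function (fun j : 'I_k => e (widen_ord (ltnW kV) j)).
have fe (i : 'I_#|V|) : mu m w i.+1 < mu m w k.+1 -> wip m (ext f) (e i) = 0.
  move=> ik; have ltik : (i < k)%N.
    rewrite ltnNge; apply: contraL ik => ki; rewrite -leNgt.
    exact: (eigenbasis_mono eb (i := Ordinal kV)).
  by rewrite -(fg (Ordinal ltik)); congr (wip _ _ (e _)); exact: val_inj.
have [le eq] := squeeze f0 fe fphi; split=> // mu_gt0 /(eq mu_gt0)[fI fe' _].
exists (ext f); split=> //; last by move=> y; exact: (harmonic_ext_interior hG hB).
split=> //; have [x fx] := f0; exists (val x).
by rewrite (harmonic_ext_boundary hG hB).
Qed.

Lemma mu_dirichlet (i : 'I_#|V|) : mu m w i.+1 = dirichlet w (e i) (e i).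
Proof.
rewrite -(green hG) -[LHS]mulr1 -(_ : wip m (e i) (e i) = 1).
  rewrite /wip mulr_sumr; apply: eq_bigr => x _.
  by rewrite (eigenbasis_eigen eb) !mulrA.
by rewrite (eigenbasis_ortho eb) eqxx.
Qed.

(** Otherwise [e i] and the first eigenfunction would both have zero energy, hence be nonzero
    constants, which are not orthogonal. *)
Lemma mu_gt0 (i : 'I_#|V|) : (0 < i)%N -> 0 < mu m w i.+1.
Proof.
move=> i0; have ge0 j : 0 <= mu m w (@nat_of_ord #|V| j).+1.
  by rewrite mu_dirichlet (dirichlet_ge0 hG).
rewrite lt_def ge0 andbT; apply/eqP => mui.
pose o : 'I_#|V| := Ordinal (leq_ltn_trans (leq0n i) (ltn_ord i)).
have muo : mu m w o.+1 = 0.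
  by apply/eqP; rewrite eq_le ge0 andbT -mui (eigenbasis_mono eb).
have cst j : mu m w (@nat_of_ord #|V| j).+1 = 0 -> forall x y, e j x = e j y.
  by rewrite mu_dirichlet; exact: (dirichlet_eq0 hG).
have [x ex] := eigenbasis_neq0 eb i; have [y ey] := eigenbasis_neq0 eb o.
have := eigenbasis_ortho eb i o.
rewrite (_ : i == o = false); last by apply/negbTE; rewrite -val_eqE /= -lt0n.
apply/eqP; rewrite /wip.
under eq_bigr => z _ do rewrite (cst i mui z x) (cst o muo z y).
rewrite -mulr_sumr mulf_neq0 ?mulf_neq0 // psumr_neq0 => [|z _]; last exact: ltW.
by apply/hasP; exists x; [exact: mem_index_enum | rewrite /= m_gt0].
Qed.

Lemma neg_laplacian1 : neg_laplacian m w (fun=> 1) =1 (fun=> 0).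
Proof. exact: neg_laplacian_const. Qed.

Lemma DtN1 : @DtN R V m w B (fun=> 1) =1 (fun=> 0).
Proof.
move=> x; rewrite /DtN (_ : ext (fun=> 1) = fun=> 1) ?normal_derivE ?neg_laplacian1 //.
apply/funext => y; apply/esym/(harmonic_ext_unique hG hB (u := fun=> 1)).
split=> // z; have := neg_laplacian1 (val z).
by rewrite /neg_laplacian => /eqP; rewrite oppr_eq0 => /eqP.
Qed.

Lemma sigma_gt0 (i : 'I_#|bvertex B|) : (0 < i)%N -> 0 < sigma m w B i.+1.
Proof.
move=> i0; apply: lt_le_trans (mu_le_sigma_ord i).1.
exact: (mu_gt0 (i := widen_ord card_boundary_le i)).
Qed.

Lemma mu1_eq0 : mu m w 1 = 0.
Proof.
have [b _] := boundary_vertex hB.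
have V0 : (0 < #|V|)%N by apply/card_gt0P; exists b.
exact: (eigval1_eq0 linN eb neg_laplacian1 mu_gt0 (i := Ordinal V0)).
Qed.

Lemma sigma1_eq0 : sigma m w B 1 = 0.
Proof.
have [b bB] := boundary_vertex hB.
have B0 : (0 < #|bvertex B|)%N by apply/card_gt0P; exists (Sub b bB).
exact: (eigval1_eq0 linD phib DtN1 sigma_gt0 (i := Ordinal B0)).
Qed.

(** As [i <= 1], an eigenvalue below that of [e i] can only be the first, and [u] has no component
    there. *)
Lemma poincare (i : 'I_#|V|) u : (i <= 1)%N ->
  wip m u (fun=> 1) = 0 -> mu m w i.+1 * wip m u u <= dirichlet w u u.
Proof.
move=> i1 u1; rewrite -(green hG); apply: (rayleigh_ge linN eb _).1 => j ji.
apply: (ortho_const linN eb neg_laplacian1 mu_gt0 u1).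
apply/eqP; rewrite -leqn0 -ltnS (leq_trans _ i1) // ltnNge.
by apply: contraL ji => ij; rewrite -leNgt; exact: (eigenbasis_mono eb).
Qed.

(* Induction on [k]: [f] is tested against the Laplacian eigenfunctions [e j]
   with [mu_j < mu_k] and, for the other [j < k], against the extensions of
   [phi j], which vanish on the interior by induction. Equality in [squeeze]
   then forces [f] to be a multiple of [phi k]. *)
Lemma ext_phi_interior :
  (forall i : 'I_#|bvertex B|, sigma m w B i.+1 = mu m w i.+1) ->
  forall (k : 'I_#|bvertex B|), (0 < k)%N -> forall y, y \notin B -> ext (phi k) y = 0.
Proof.
move=> sm k; have [n] := ubnP k; elim: n k => // n IHn k /ltnSE kn k0.
have kV : (k < #|V|)%N by exact: leq_trans (ltn_ord k) card_boundary_le.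
have muk : 0 < mu m w k.+1 by exact: (mu_gt0 (i := Ordinal kV)).
pose g (j : 'I_k) := if mu m w j.+1 < mu m w k.+1 then e (widen_ord (ltnW kV) j)
  else ext (phi (widen_ord (ltnW (ltn_ord k)) j)).
have [f [f0 fg fphi]] := test_function g.
have fe (i : 'I_#|V|) : mu m w i.+1 < mu m w k.+1 -> wip m (ext f) (e i) = 0.
  move=> ik; have ltik : (i < k)%N.
    rewrite ltnNge; apply: contraL (ik) => ki; rewrite -leNgt.
    exact: (eigenbasis_mono eb (i := Ordinal kV)).
  by rewrite -(fg (Ordinal ltik)) /g /= ik; congr (wip _ _ (e _)); exact: val_inj.
have [_ /(_ muk (sm k)) [fI _ fD]] := squeeze f0 fe fphi.
have coord (j : 'I_#|bvertex B|) : j != k -> wip mB f (phi j) = 0.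
  move=> jk; have [|kj] := leqP j k; last exact: fphi.
  rewrite leq_eqVlt val_eqE (negPf jk) /= => ltjk.
  have [lt|ge] := ltP (mu m w j.+1) (mu m w k.+1).
    (* The coordinate of [DtN m w f] along [phi j] is that of [f] times both [sigma_j] and
       [sigma_k], which differ here. *)
    have := eigenbasis_coord linD phib f j.
    rewrite (_ : wip _ _ _ = sigma m w B k.+1 * wip mB f (phi j)).
      move/eqP; rewrite -subr_eq0 -mulrBl mulf_eq0 subr_eq0 => /orP[/eqP|/eqP//].
      by rewrite -/(sigma m w B _) !sm => eq; rewrite eq ltxx in lt.
    by rewrite /wip mulr_sumr; apply: eq_bigr => x _; rewrite fD !mulrA.
  have j0 : (0 < j)%N.
    by rewrite lt0n; apply: contraL ge => /eqP->; rewrite mu1_eq0 -ltNge.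
  (* Since [ext f] vanishes on the interior, orthogonality of the extensions over [V] is
     orthogonality of [f] and [phi j] over the boundary. *)
  have := fg (Ordinal ltjk); rewrite /g /= ltNge ge /=.
  rewrite (_ : widen_ord _ _ = j); last exact: val_inj.
  rewrite (wip_split m B) [X in _ + X]big1 ?addr0 => [<-|y _].
    by apply: eq_bigr => x _; rewrite !(harmonic_ext_boundary hG hB).
  by rewrite fI ?mul0r // (valP y).
move=> y yB; have := fI y yB; rewrite ext_sum (bigD1 k) //= big1 ?addr0 => [|j jk].
  move/eqP; rewrite mulf_eq0 => /orP[/eqP ck|/eqP //].
  have [x] := f0; rewrite (eigenbasis_total phib f x) big1 ?eqxx // => j _.
  by have [->|/coord->] := eqVneq j k; rewrite ?ck mul0r.
by rewrite coord ?mul0r.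
Qed.

(** Zero mean removes the component along the first Steklov eigenfunction; all the others have
    extensions vanishing on the interior. *)
Lemma ext_interior f :
  (forall i : 'I_#|bvertex B|, sigma m w B i.+1 = mu m w i.+1) ->
  wip mB f (fun=> 1) = 0 -> forall y, y \notin B -> ext f y = 0.
Proof.
move=> sm f1 y yB; rewrite ext_sum big1 // => i _.
have [i0|i0] := posnP i; last by rewrite ext_phi_interior ?mulr0.
by rewrite (ortho_const linD phib DtN1 sigma_gt0 f1) ?mul0r.
Qed.

End Comparison.

(** * Product weights *)

Section ProductWeight.
Variables (R : realType) (V : finType) (E : rel V) (m : V -> R) (w : V -> V -> R).
Variable (B : {set V}).
Hypothesis hG : weighted_graph E m w.
Hypothesis hB : graph_boundary E B.
Local Notation mB := (fun x : bvertex B => m (val x)).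
Local Notation ext := (@harmonic_ext R V m w B).
Implicit Types (rho : interior B -> R) (u v : V -> R) (f : bvertex B -> R).

Let m_gt0 x : 0 < m x. Proof. by case: hG => _ []. Qed.
Let m_neq0 x : m x != 0. Proof. by rewrite gt_eqF. Qed.
Let wC x y : w x y = w y x. Proof. by case: hG => _ []. Qed.
Let w_gt0 x y : E x y -> 0 < w x y. Proof. by case: hG => _ [] _ _ + _; apply. Qed.
Let w_eq0 x y : ~~ E x y -> w x y = 0. Proof. by case: hG => _ [] _ _ _; apply. Qed.

Lemma weight_boundary (x y : bvertex B) : w (val x) (val y) = 0.
Proof. by apply: w_eq0; case: hB => _ + _; apply; [exact: valP x|exact: valP y]. Qed.

Lemma laplacian_interior_eq0 u (y : interior B) :
  (forall z : interior B, u (val z) = 0) ->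
  laplacian m w u (val y) = (m (val y))^-1 * \sum_(x : bvertex B) u (val x) * w (val x) (val y).
Proof.
move=> u0; rewrite /laplacian (sum_vertices B) [X in _ + X]big1 ?addr0 => [|z _].
  by congr (_ * _); apply: eq_bigr => x _; rewrite u0 subr0 wC.
by rewrite !u0 subrr mul0r.
Qed.

(* Harmonicity at [y] of an extension vanishing on the interior says that
   [x |-> w x y] is orthogonal to [f]; as [f] ranges over the functions of zero
   mean, [x |-> w x y] is proportional to the vertex measure. *)
Lemma product_weight_exists :
  (forall f, wip mB f (fun=> 1) = 0 -> forall y, y \notin B -> ext f y = 0) ->
  exists rho, product_weight m w rho.
Proof.
move=> ext0; have [b bB] := boundary_vertex hB.
exists (fun y => w b (val y) / (m b * m (val y))); split.
  by move=> y; rewrite divr_ge0 ?(weight_ge0 hG) // mulr_ge0 ?ltW.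
move=> x y.
pose b' : bvertex B := Sub b bB.
(* A zero-mean test function comparing [x] with the reference vertex [b]: against [F] it gives
   [F x / m x - F b / m b]. *)
pose f z : R := (z == x)%:R / m (val x) - (z == b')%:R / m b.
have delta (F : bvertex B -> R) :
    \sum_z f z * F z = F x / m (val x) - F b' / m b.
  rewrite /f; under eq_bigr do rewrite mulrBl.
  rewrite sumrB (bigD1 x) //= eqxx big1 => [|z /negPf->]; last by rewrite !mul0r.
  rewrite (bigD1 b') //= eqxx big1 => [|z /negPf->]; last by rewrite !mul0r.
  by rewrite !div1r !addr0 (mulrC _ (F x)) (mulrC _ (F b')).
have f1 : wip mB f (fun=> 1) = 0.
  by rewrite /wip; under eq_bigr do rewrite mulr1; rewrite delta !divff // subrr.
have := harmonic_ext_interior hG hB f (valP y).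
rewrite laplacian_interior_eq0 => [|z]; last by rewrite ext0 // (valP z).
under eq_bigr do rewrite (harmonic_ext_boundary hG hB).
rewrite delta => /eqP; rewrite mulf_eq0 invr_eq0 (negPf (m_neq0 _)) /= subr_eq0.
move=> /eqP wx; rewrite -[LHS](divfK (m_neq0 (val x))) wx /=.
by field; rewrite !m_neq0.
Qed.

Variable (rho : interior B -> R).
Hypothesis hrho : product_weight m w rho.
Let Dg := inner_int m rho (fun=> 1).

Let wE (x : bvertex B) (y : interior B) :
  w (val x) (val y) = rho y * m (val x) * m (val y).
Proof. by case: hrho. Qed.

Lemma product_weight_adjacent (y : interior B) :
  (forall x, x \in B -> E x (val y)) \/ (forall x, x \in B -> ~~ E x (val y)).
Proof.
have [r0|r0] := eqVneq (rho y) 0; [right|left] => x xB.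
  apply/negP => /w_gt0; rewrite -[x]/(val (Sub x xB : bvertex B)) wE r0 !mul0r.
  by rewrite ltxx.
apply: contraNT r0 => /w_eq0; rewrite -[x]/(val (Sub x xB : bvertex B)) wE.
by move/eqP; rewrite !mulf_eq0 !(negPf (m_neq0 _)) !orbF.
Qed.

Lemma sum_boundary_weight (x : bvertex B) (c : R) :
  (m (val x))^-1 * \sum_(y : interior B) c * w (val x) (val y) = c * Dg.
Proof.
rewrite mulr_sumr /Dg /inner_int mulr_sumr; apply: eq_bigr => y _.
by rewrite wE; field; exact: m_neq0.
Qed.

Lemma product_weight_wdeg x : x \in B -> wdeg m w x = Dg.
Proof.
move=> xB; rewrite -[x]/(val (Sub x xB : bvertex B)) /wdeg (sum_vertices B) big1.
  rewrite add0r -[RHS]mul1r -(sum_boundary_weight (Sub x xB)).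
  by congr (_ * _); apply: eq_bigr => y _; rewrite mul1r.
by move=> y _; rewrite weight_boundary.
Qed.

Lemma degree_gt0 : 0 < Dg.
Proof.
have [b bB] := boundary_vertex hB; rewrite -(product_weight_wdeg bB) /wdeg.
rewrite mulr_gt0 ?invr_gt0 //; case: hB => _ _ /(_ b bB)[y _ Eby].
rewrite (bigD1 y) //= ltr_pwDl ?w_gt0 // sumr_ge0 // => z _.
exact: (weight_ge0 hG).
Qed.

Lemma normal_deriv_product u (x : bvertex B) : (forall y : interior B, u (val y) = 0) ->
  normal_deriv m w u (val x) = Dg * u (val x).
Proof.
move=> u0; rewrite /normal_deriv (sum_vertices B) big1 => [|y _]; last first.
  by rewrite weight_boundary mulr0.
rewrite add0r mulrC [RHS]mulrC -(sum_boundary_weight x) mulrC; congr (_ * _).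
by apply: eq_bigr => y _; rewrite u0 subr0.
Qed.

(** The extension of [f] by zero is harmonic: its Laplacian at an interior [y] is [rho y] times the
    vanishing sum of [f]. *)
Lemma DtN_product f : wip mB f (fun=> 1) = 0 -> DtN m w f =1 (fun x => Dg * f x).
Proof.
move=> f1 x; pose u (z : V) := oapp f 0 (insub z).
have uB (z : bvertex B) : u (val z) = f z by rewrite /u valK.
have uI (y : interior B) : u (val y) = 0.
  by rewrite /u insubF //; apply/negbTE/(valP y).
have -> : DtN m w f x = normal_deriv m w u (val x).
  rewrite /DtN (_ : ext f = u) //; apply/funext => z.
  apply/esym/(harmonic_ext_unique hG hB); split=> // y.
  rewrite laplacian_interior_eq0 // [X in _ * X](_ : _ = rho y * m (val y) * wip mB f (fun=> 1)).
    by rewrite f1 !mulr0.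
  by rewrite /wip mulr_sumr; apply: eq_bigr => z' _; rewrite wE uB; ring.
by rewrite normal_deriv_product // uB.
Qed.

(** No edge joins two boundary vertices. The edges between boundary and interior contribute
    [(f x - u' y)^2] with product weights, and expanding the square separates the two sums. *)
Lemma dirichlet_product u :
  let f := fun x : bvertex B => u (val x) in
  let u' := fun y : interior B => u (val y) in
  dirichlet w u u = energy_int E w u' + Dg * wip mB f f
    - 2 * wip mB f (fun=> 1) * inner_int m rho u'
    + volume m B * inner_int m (fun y => rho y * u' y) u'.
Proof.
move=> f u'.
have -> : volume m B = wip mB (fun=> 1) (fun=> 1).
  rewrite /volume /wip (big_sub (mem B)) //=.
  by apply: eq_bigr => x _; rewrite !mul1r.
pose T x y := (u x - u y) * (u x - u y) * w x y.
have TC x y : T x y = T y x by rewrite /T wC; ring.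
pose C := \sum_(x : bvertex B) \sum_(y : interior B) T (val x) (val y).
have CE : C = Dg * wip mB f f - 2 * wip mB f (fun=> 1) * inner_int m rho u'
    + wip mB (fun=> 1) (fun=> 1) * inner_int m (fun y => rho y * u' y) u'.
  transitivity (wip mB f f * Dg + (-2 * (wip mB f (fun=> 1) * inner_int m rho u')
    + wip mB (fun=> 1) (fun=> 1) * inner_int m (fun y => rho y * u' y) u')); last by ring.
  rewrite /C /Dg /wip /inner_int !big_distrlr /= mulr_sumr -!big_split /=.
  apply: eq_bigr => x _; rewrite mulr_sumr -!big_split /=; apply: eq_bigr => y _.
  by rewrite /T wE /f /u'; ring.
have EE : energy_int E w u' = 2^-1 * \sum_(x : interior B) \sum_(y : interior B) T (val x) (val y).
  congr (_ * _); apply: eq_bigr => x _; rewrite big_mkcond; apply: eq_bigr => y _ /=.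
  by rewrite /T /u'; case: ifP => [_|/negbT/w_eq0->]; rewrite ?mulr0 ?expr2.
transitivity (energy_int E w u' + C); last by rewrite CE; ring.
rewrite EE /dirichlet.
rewrite (sum_vertices B) [X in _ * (X + _)](_ : _ = C); last first.
  apply: eq_bigr => x _; rewrite (sum_vertices B) [X in X + _]big1 ?add0r // => y _.
  by rewrite weight_boundary mulr0.
rewrite [X in _ * (_ + X)](_ : _ = C + \sum_(x : interior B) \sum_(y : interior B) T (val x) (val y)).
  by field.
rewrite /C [in RHS]exchange_big -big_split /=; apply: eq_bigr => x _.
by rewrite (sum_vertices B); congr (_ + _); apply: eq_bigr => y _; rewrite TC.
Qed.

Lemma volume_gt0 (A : {set V}) x : x \in A -> 0 < volume m A.
Proof.
move=> xA; rewrite /volume (bigD1 x) //= ltr_pwDl // sumr_ge0 // => y _.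
exact: ltW.
Qed.

Lemma volume_interior : volume m (~: B) = inner_int m (fun=> 1) (fun _ : interior B => 1).
Proof.
rewrite /volume (eq_bigl [pred y | y \notin B]) => [|y]; last first.
  by rewrite finset.in_setC.
by rewrite (big_sub [pred y | y \notin B]); apply: eq_bigr => y _; rewrite !mul1r.
Qed.

(* Writing [u = u0 + b] on the interior with [u0] of zero mean, completing the
   square in [b] leaves exactly the quadratic form of [interior_ineq]. *)
Lemma dirichlet_complete_square u (u0 : interior B -> R) (b : R) :
  let VG := volume m B + volume m (~: B) in
  wip m u (fun=> 1) = 0 -> (forall y, u (val y) = u0 y + b) ->
  inner_int m u0 (fun=> 1) = 0 ->
  dirichlet w u u - Dg * wip m u u =
    energy_int E w u0 - Dg * inner_int m u0 u0
    + volume m B * inner_int m (fun y => rho y * u0 y) u0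
    - VG / Dg * inner_int m rho u0 ^+ 2
    + VG / Dg * (inner_int m rho u0 + b * Dg) ^+ 2.
Proof.
move=> VG u1 uE u01; have Dg0 := gt_eqF degree_gt0.
pose u' := fun y : interior B => u (val y).
have u'E : u' = fun y => u0 y + b by apply/funext.
have EE : energy_int E w u' = energy_int E w u0.
  congr (_ * _); apply: eq_bigr => x _; apply: eq_bigr => y _.
  by rewrite u'E opprD addrACA subrr addr0.
have H1 : inner_int m rho u' = inner_int m rho u0 + b * Dg.
  rewrite /Dg /inner_int mulr_sumr -big_split; apply: eq_bigr => y _ /=.
  by rewrite u'E; ring.
have H2 : inner_int m (fun y => rho y * u' y) u' =
    inner_int m (fun y => rho y * u0 y) u0 + (2 * b * inner_int m rho u0 + b ^+ 2 * Dg).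
  rewrite /Dg /inner_int !mulr_sumr -!big_split; apply: eq_bigr => y _ /=.
  by rewrite u'E; ring.
have H3 : inner_int m u' u' = inner_int m u0 u0 + b ^+ 2 * volume m (~: B).
  rewrite -[LHS]subr0 -(mulr0 (2 * b)) -u01 volume_interior /inner_int !mulr_sumr.
  rewrite -sumrB -big_split; apply: eq_bigr => y _ /=.
  by rewrite u'E; ring.
have H4 : wip mB (fun x => u (val x)) (fun=> 1) = - (b * volume m (~: B)).
  apply/eqP; rewrite -addr_eq0 -u1 (wip_split m B); apply/eqP; congr (_ + _).
  rewrite -[LHS]add0r -u01 volume_interior /inner_int !mulr_sumr -big_split.
  by apply: eq_bigr => y _ /=; rewrite uE; ring.
(* The squared norm on the boundary cancels, so the boundary values enter only through their sum,
   given by [H4]. *)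
rewrite dirichlet_product (wip_split m B u) -/u' EE H1 H2 H3 H4 /VG.
by field; rewrite Dg0.
Qed.

(** One direction takes for [b] the interior mean of [u] and drops the completed square; the other
    picks [u] for which that square is zero. *)
Lemma interior_ineq_poincare : interior_ineq E m w rho <->
  forall u, wip m u (fun=> 1) = 0 -> Dg * wip m u u <= dirichlet w u u.
Proof.
have [x0 x0B] := boundary_vertex hB.
have VB_gt0 := volume_gt0 x0B.
have VI_gt0 : 0 < volume m (~: B).
  by case: hB => _ _ /(_ _ x0B)[y yB _]; apply: (volume_gt0 (x := y)); rewrite inE.
have Dg0 := degree_gt0.
split=> [H u u1|H]; last rewrite /interior_ineq /= => u0 u01.
  pose b := inner_int m (fun y : interior B => u (val y)) (fun=> 1) / volume m (~: B).
  pose u0 (y : interior B) := u (val y) - b.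
  have u01 : inner_int m u0 (fun=> 1) = 0.
    rewrite (_ : inner_int m u0 _ = inner_int m (fun y : interior B => u (val y)) (fun=> 1)
      - b * volume m (~: B)); first by rewrite /b divfK ?subrr // gt_eqF.
    rewrite volume_interior /inner_int mulr_sumr -sumrB.
    by apply: eq_bigr => y _; rewrite /u0; ring.
  rewrite -subr_ge0 (dirichlet_complete_square (u0 := u0) (b := b)) //; last first.
    by move=> y; rewrite /u0 subrK.
  apply: addr_ge0; first exact: H u01.
  by rewrite mulr_ge0 ?sqr_ge0 // divr_ge0 ?addr_ge0 ?ltW.
(* This [b] annihilates the completed square, and the constant boundary value [a] restores total
   mean zero. *)
pose b := - inner_int m rho u0 / Dg.
pose a := - (b * volume m (~: B)) / volume m B.
pose u (z : V) := oapp (fun y : interior B => u0 y + b) a (insub z).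
have uI (y : interior B) : u (val y) = u0 y + b by rewrite /u valK.
have uB (x : bvertex B) : u (val x) = a.
  by rewrite /u insubF //; apply/negbTE; rewrite negbK (valP x).
have u1 : wip m u (fun=> 1) = 0.
  rewrite (wip_split m B) (_ : wip _ _ _ = a * volume m B).
    rewrite /a divfK ?gt_eqF // (_ : inner_int _ _ _ = b * volume m (~: B)) ?addNr //.
    rewrite -[RHS]add0r -u01 volume_interior /inner_int mulr_sumr -big_split.
    by apply: eq_bigr => y _; rewrite /= uI; ring.
  rewrite /volume (big_sub (mem B)) mulr_sumr; apply: eq_bigr => x _.
  by rewrite uB mulr1.
have := H u u1; rewrite -subr_ge0 (dirichlet_complete_square u1 uI u01).
rewrite [X in _ + _ / _ * X](_ : _ = 0) ?mulr0 ?addr0 //.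
by rewrite /b divfK ?subrr ?expr0n // gt_eqF.
Qed.

End ProductWeight.

(** * Assembly of the inequality, its equality case and the characterisation of equal spectra *)

Theorem theorem1p1 (R : realType) (V : finType) (E : rel V)
    (m : V -> R) (w : V -> V -> R) (B : {set V})
    (hG : weighted_graph E m w) (hB : graph_boundary E B) :
  [/\ (forall i : nat, (1 <= i <= #|B|)%N -> mu m w i <= sigma m w B i),
      (forall i : nat, (2 <= i <= #|B|)%N -> sigma m w B i = mu m w i ->
         exists v : V -> R,
           [/\ eigenfunction (neg_laplacian m w) (mu m w i) v,
               (forall y, y \notin B -> v y = 0) &
               (forall y, y \notin B -> laplacian m w v y = 0)]),
      ((2 <= #|B|)%N ->
         ((forall i : nat, (1 <= i <= #|B|)%N -> sigma m w B i = mu m w i) <->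
          exists rho : interior B -> R,
            product_weight m w rho /\ interior_ineq E m w rho)) &
      (forall rho : interior B -> R, product_weight m w rho ->
         (forall y : interior B,
            (forall x, x \in B -> E x (val y)) \/
            (forall x, x \in B -> ~~ E x (val y))) /\
         (forall x, x \in B ->
            wdeg m w x = inner_int m rho (fun=> 1)))].
Proof.
have [e eb] := laplacian_eigenbasis hG; have [phi phib] := DtN_eigenbasis hG hB.
have cB : #|bvertex B| = #|B| by rewrite card_sig.
have leBV := card_boundary_le B.
have ordB (i : nat) : (1 <= i <= #|B|)%N ->
    exists k : 'I_#|bvertex B|, i = k.+1.
  case: i => // i iB; have iB' : (i < #|bvertex B|)%N by rewrite cB.
  by exists (Ordinal iB').
have linD := DtN_linear hG hB.
have D1 := DtN1 hG hB; have sg0 := sigma_gt0 hG hB eb phib.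
(* For [k > 0], [phi k] is orthogonal to constants, so [DtN_product] gives its eigenvalue. *)
have sigma_product (rho : interior B -> R) : product_weight m w rho ->
    forall k : 'I_#|bvertex B|, (0 < k)%N ->
    sigma m w B k.+1 = inner_int m rho (fun=> 1).
  move=> hrho k k0; have [x phx] := eigenbasis_neq0 phib k.
  apply: (mulIf phx); rewrite -(eigenbasis_eigen phib).
  rewrite (DtN_product hG hB hrho) //.
  by rewrite wipC (const_coord linD phib D1 sg0).
split.
- by move=> i /ordB[k ->]; exact: (mu_le_sigma_ord hG hB eb phib k).1.
- move=> i /andP[i2 iB]; have [|k ik] := ordB i; first by rewrite iB (ltnW i2).
  rewrite ik in i2 *; apply: (mu_le_sigma_ord hG hB eb phib k).2.
  exact: (mu_gt0 hG eb (i := widen_ord leBV k)).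
- move=> B2; split=> [sm|[rho [hrho rhoI]]].
    have sm' (i : 'I_#|bvertex B|) : sigma m w B i.+1 = mu m w i.+1.
      by apply: sm; rewrite /= -cB.
    have [rho hrho] := product_weight_exists hG hB
      (fun f f1 => ext_interior hG hB eb phib sm' f1).
    exists rho; split=> //; apply/(interior_ineq_poincare hG hB hrho) => u u1.
    have B1 : (1 < #|bvertex B|)%N by rewrite cB.
    (* The degree equals the second Steklov eigenvalue, hence the second Laplacian eigenvalue, which
       is the Poincare constant. *)
    rewrite -(sigma_product _ hrho (Ordinal B1)) // sm'.
    exact: (poincare hG eb (i := widen_ord leBV (Ordinal B1))).
  move=> i /ordB[k ->]; have [->|k0] := posnP k.
    by rewrite (sigma1_eq0 hG hB eb phib) (mu1_eq0 hG hB eb).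
  (* For the reverse bound, the Poincare inequality is tested on the normalised Laplacian
     eigenfunction, whose energy is its eigenvalue. *)
  apply/eqP; rewrite eq_le (mu_le_sigma_ord hG hB eb phib k).1 andbT.
  rewrite (sigma_product _ hrho) // (mu_dirichlet hG eb (widen_ord leBV k)).
  have := (interior_ineq_poincare hG hB hrho).1 rhoI (e (widen_ord leBV k)).
  rewrite (eigenbasis_ortho eb) eqxx mulr1; apply; rewrite wipC.
  exact: (const_coord (@neg_laplacian_linear _ _ m w) eb
    (neg_laplacian1 m w) (mu_gt0 hG eb)).
- move=> rho hrho; split; first by move=> y; apply: (product_weight_adjacent hG hrho).
  exact: (product_weight_wdeg hG hB hrho).
Qed.
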